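(* Let $\mathfrak{g}$ be a finite-dimensional real Lie algebra, let $\phi$ be an NDB structure on $\mathfrak{g}$, and let $\triangle_\phi$ be the left-symmetric structure on $\mathfrak{g}$ defined by $\phi(x\triangle_\phi y,z)=-\phi(y,[x,z])$ for all $x,y,z\in\mathfrak{g}$. Then $\triangle_\phi$ is complete if and only if $\mathfrak{g}$ is unimodular.
   Context: A bilinear form $\phi$ on a finite-dimensional real vector space $V$ is non-degenerate if $V\to V^*$, $x\mapsto\phi(x,\cdot)$, is an isomorphism. Write $\phi=\phi_S+\phi_A$ with $\phi_S$ the symmetric part and $\phi_A$ the skew-symmetric part. An NDB structure on a Lie algebra $\mathfrak{g}$ is a non-degenerate bilinear form $\phi$ on $\mathfrak{g}$ such that $\phi_A([x,y],z)+\phi_A([y,z],x)+\phi_A([z,x],y)=\phi_S(x,[y,z])$ for all $x,y,z\in\mathfrak{g}$. A left-symmetric structure on $\mathfrak{g}$ is a bilinear product $\triangle$ on $\mathfrak{g}$ with $x\triangle(y\triangle z)-(x\triangle y)\triangle z=y\triangle(x\triangle z)-(y\triangle x)\triangle z$ and $[x,y]=x\triangle y-y\triangle x$ for all $x,y,z\in\mathfrak{g}$. It is complete if for every $x\in\mathfrak{g}$ the right multiplication $r(x)\colon\mathfrak{g}\to\mathfrak{g}$, $r(x)(y)=y\triangle x$, is nilpotent. $\mathfrak{g}$ is unimodular if $\operatorname{tr}(\operatorname{ad}(x))=0$ for all $x\in\mathfrak{g}$. *)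

(* Defs.v *)
From HB Require Import structures.
From mathcomp Require Import all_boot all_order all_algebra.
From mathcomp Require Import reals lra.

Set Implicit Arguments.
Unset Strict Implicit.
Unset Printing Implicit Defensive.

Import GRing.Theory.
Local Open Scope ring_scope.

Section Definitions.
Context {R : realType} {V : vectType R}.
Implicit Types (br tri : {bilinear V -> V -> V}) (phi : {biscalar V}).

Definition lie_bracket br : Prop :=
  (forall x, br x x = 0) /\
  (forall x y z, br x (br y z) + br y (br z x) + br z (br x y) = 0).

Definition sym_part phi (x y : V) : R := (phi x y + phi y x) / 2.

Definition skew_part phi (x y : V) : R := (phi x y - phi y x) / 2.

(* x |-> phi(x, .), as a map from V to its dual 'Hom(V, R^o); it is linear in
   x (lemma [flat_is_linear] below), so it is an isomorphism iff bijective. *)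
Definition flat phi (x : V) : 'Hom(V, R^o) := linfun (phi x : V -> R^o).

Definition nondegenerate phi : Prop := bijective (flat phi).

Definition NDB_structure br phi : Prop :=
  nondegenerate phi /\
  (forall x y z,
     skew_part phi (br x y) z + skew_part phi (br y z) x
       + skew_part phi (br z x) y
     = sym_part phi x (br y z)).

Definition left_symmetric_structure br tri : Prop :=
  (forall x y z, tri x (tri y z) - tri (tri x y) z
                 = tri y (tri x z) - tri (tri y x) z) /\
  (forall x y, br x y = tri x y - tri y x).

Definition right_mul tri (x y : V) : V := tri y x.

Definition nilpotent_map (f : V -> V) : Prop :=
  exists n : nat, forall y, iter n f y = 0.

Definition complete tri : Prop := forall x, nilpotent_map (right_mul tri x).

Definition ad br (x : V) : 'End(V) := linfun (br x).

(* The trace of the matrix of f in the basis [vbasis {:V}]; the choice of basis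
   is irrelevant (lemma [lfun_trace_basis] below). *)
Definition lfun_trace (f : 'End(V)) : R :=
  \tr (passmx.mxof (vbasis {:V}) (vbasis {:V}) f).

Definition unimodular br : Prop := forall x, lfun_trace (ad br x) = 0.

Definition ndb_product_of br phi tri : Prop :=
  forall x y z, phi (tri x y) z = - phi y (br x z).

End Definitions.

Section Facts.
Context {R : realType} {V : vectType R}.
Implicit Types (br tri : {bilinear V -> V -> V}) (phi : {biscalar V}).

Lemma lfun_trace_basis (e : (\dim {:V}).-tuple V) (f : 'End(V)) :
  basis_of {:V} e -> lfun_trace f = \tr (passmx.mxof e e f).
Proof.
move=> eb; have bb : basis_of {:V} (vbasis {:V}) := vbasisP _.
pose b := vbasis {:V}.
pose P := passmx.mxof b e \1%VF; pose Q := passmx.mxof e b \1%VF.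
have PQ : P *m Q = 1%:M.
  apply/row_matrixP => i; rewrite !rowE mulmxA !passmx.mul_mxof !lfunE /=.
  by rewrite passmx.rVofK // passmx.vecofK // mulmx1.
rewrite /lfun_trace -/b.
have -> : passmx.mxof b b f = P *m passmx.mxof e e f *m Q.
  apply/row_matrixP => i; rewrite !rowE !mulmxA !passmx.mul_mxof !lfunE /=.
  by rewrite !passmx.rVofK.
by rewrite mxtrace_mulC mulmxA (mulmx1C PQ) mul1mx.
Qed.

Lemma flatE phi x z : flat phi x z = phi x z.
Proof.
have lin : linear (phi x : V -> R^o) by move=> a u v; rewrite linearPr.
pose h := HB.pack (phi x : V -> R^o)
  (GRing.isSemilinear.Build R V R^o _ (phi x : V -> R^o)
     (GRing.semilinear_linear lin)) : {linear V -> R^o}.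
exact: (lfunE h z).
Qed.

Lemma adE br x y : ad br x y = br x y.
Proof. by rewrite /ad lfunE. Qed.

Lemma flat_is_linear phi : linear (flat phi).
Proof.
move=> a x y; apply/lfunP => z.
by rewrite !lfunE /= !lfunE /= !flatE linearPl.
Qed.

Lemma ad_is_linear br : linear (ad br).
Proof.
move=> a x y; apply/lfunP => z.
by rewrite !lfunE /= !lfunE /= !adE linearPl.
Qed.

Lemma nondegenerate_inj phi (u v : V) : nondegenerate phi ->
  (forall z, phi u z = phi v z) -> u = v.
Proof.
by move=> /bij_inj inj e; apply: inj; apply/lfunP => z; rewrite !flatE.
Qed.

(* The product determined by an NDB structure exists, is unique, and is a
   left-symmetric structure. *)
Lemma ndb_product_exists br phi : nondegenerate phi ->
  exists tri, ndb_product_of br phi tri.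
Proof.
move=> nd; have [g fK gK] := nd.
pose m x y : V := g (- (flat phi y \o ad br x)%VF).
have mE x y z : phi (m x y) z = - phi y (br x z).
  by rewrite -flatE /m gK !lfunE /= !lfunE /= flatE adE.
have mlin : bilinear_for ( *:%R : GRing.Scale.law R V) *:%R m.
  split=> [y a x x' | x a y y']; apply: (nondegenerate_inj nd) => z.
    by rewrite linearPl !mE /= linearPl linearPr opprD mulrN.
  by rewrite linearPl !mE /= linearPl opprD mulrN.
pose tri := HB.pack m (bilinear_isBilinear.Build R V V V _ _ m mlin)
  : {bilinear V -> V -> V}.
by exists tri.
Qed.

Lemma ndb_product_unique br phi tri tri' : nondegenerate phi ->
  ndb_product_of br phi tri -> ndb_product_of br phi tri' ->
  forall x y, tri x y = tri' x y.
Proof.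
by move=> nd H H' x y; apply: (nondegenerate_inj nd) => z; rewrite H H'.
Qed.

Lemma ndb_product_left_symmetric br phi tri :
  lie_bracket br -> NDB_structure br phi -> ndb_product_of br phi tri ->
  left_symmetric_structure br tri.
Proof.
move=> [alt jac] [nd ndb] H.
have anti x y : br x y = - br y x.
  apply/eqP; rewrite -addr_eq0; apply/eqP.
  have := alt (x + y); rewrite linearDl !linearDr /= !alt.
  by rewrite add0r addr0.
have tors x y : br x y = tri x y - tri y x.
  apply: (nondegenerate_inj nd) => z; rewrite linearBl /= !H.
  have := ndb x y z; have := ndb y z x; have := ndb z x y.
  rewrite /skew_part /sym_part (anti x z) !linearNr /=.
  by lra.
split=> // x y z; apply: (nondegenerate_inj nd) => w.
have e : tri (tri x y) z - tri (tri y x) z = tri (br x y) z.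
  by rewrite tors linearBl.
apply/eqP; rewrite -subr_eq0 -linearBl /=.
have -> : tri x (tri y z) - tri (tri x y) z -
          (tri y (tri x z) - tri (tri y x) z)
        = tri x (tri y z) - tri y (tri x z) - tri (br x y) z.
  by rewrite -e !opprD !opprK addrACA.
rewrite !linearBl /= !H !opprK -linearBr -linearDr /=.
have := jac x y w; rewrite (anti w x) (anti w (br x y)) linearNr /= => j.
have -> : br y (br x w) - br x (br y w) + br (br x y) w
        = - (br x (br y w) + - br y (br x w) + - br (br x y) w).
  by rewrite !opprD !opprK (addrC (br y _)).
by rewrite j oppr0 linear0r.
Qed.

End Facts.

(* Main.v *)
Require Import Defs.
From mathcomp Require Import all_boot all_order all_algebra.
From mathcomp Require Import reals.
Import GRing.Theory Num.Theory passmx.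
Local Open Scope ring_scope.

(** Write L_x, R_x for the left and right multiplications of the left-symmetric
product. The defining relation phi(L_x y, z) = - phi(y, ad_x z) says that L_x
is adjoint to - ad_x, so tr L_x = - tr ad_x; since ad_x = L_x - R_x, this gives
tr R_x = - 2 tr ad_x ([mxtrace_rmulmx]). Hence unimodularity means exactly that
every R_x has trace zero.

If the product is complete, every R_x is nilpotent, so has trace zero.
Conversely, suppose that every R_x has trace zero. Left symmetry, read as an
identity between operators, is R_{x.v} = R_v R_x + [L_x, R_v] (composition of
operators). Multiply by (R_v)^j and take traces: the commutator term drops out,
because R_v commutes with its own powers, and
tr ((R_v)^j R_{x.v}) = tr ((R_v)^(j+1) R_x). By induction on j all the traces
tr ((R_v)^j R_x) vanish; with x = v this says that all positive powers of R_v
have trace zero ([mxtrace_rmulmx_expr]). In characteristic zero such an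
operator is nilpotent ([nilpotent_mxtrace_expr]).

Both facts about nilpotency and traces come from a rank factorization A = C D:
the smaller matrix D C has the same traces of positive powers as A, and
A^(k+1) = C (D C)^k D. *)

(** * Traces of powers and nilpotency of matrices *)

Lemma expr_mulmx_rot (R : pzRingType) m n (C : 'M[R]_(m, n))
    (D : 'M[R]_(n, m)) k :
  (C *m D) ^+ k.+1 = C *m (D *m C) ^+ k *m D.
Proof.
elim: k => [|k IHk]; first by rewrite expr0 mulmx1 expr1.
by rewrite exprSr IHk exprSr -!mulmxE !mulmxA.
Qed.

Lemma mxtrace_expr_mulmx (R : comPzRingType) m n (C : 'M[R]_(m, n))
    (D : 'M[R]_(n, m)) k :
  \tr ((D *m C) ^+ k.+1) = \tr ((C *m D) ^+ k.+1).
Proof. by rewrite expr_mulmx_rot mxtrace_mulC mulmxA exprS. Qed.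

(** Induction on the nilpotency index: for a rank factorization A = C D, the
outer factors cancel in C (D C)^k D = A^(k+1) = 0, so the index of D C is
smaller by one, while its trace is that of A. *)
Lemma mxtrace_nilpotent (F : fieldType) k n (A : 'M[F]_n) :
  A ^+ k = 0 -> \tr A = 0.
Proof.
elim: k n A => [|k IHk] n A Ak0.
  (* Here 1 = A ^+ 0 = 0, that is, the size n is zero. *)
  by rewrite -[A]mulmx1 -[1%:M]/(A ^+ 0) Ak0 mulmx0 mxtrace0.
rewrite -(mulmx_base A) mxtrace_mulC; apply: IHk.
apply: (row_full_inj (col_base_full A)).
apply: (row_free_inj (row_base_free A)).
by rewrite -expr_mulmx_rot mulmx_base Ak0 mulmx0 mul0mx.
Qed.

Lemma mxtrace_horner_mx (F : fieldType) n (A : 'M[F]_n.+1) (p : {poly F}) :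
  (forall k, \tr (A ^+ k.+1) = 0) -> \tr (horner_mx A p) = p`_0 *+ n.+1.
Proof.
move=> trA; rewrite -[p in LHS]coefK poly_def rmorph_sum raddf_sum /=.
under eq_bigr => i _ do rewrite linearZ rmorphXn /= horner_mx_X linearZ /=.
case sp: (size p) => [|s].
  by rewrite big_ord0 nth_default ?sp // mul0rn.
rewrite big_ord_recl big1 => [|i _]; last by rewrite trA mulr0.
by rewrite expr0 mxtrace1 addr0 mulr_natr.
Qed.

(** Induction on the size. Taking traces in the Cayley-Hamilton identity shows
that n * det A = 0, so A is singular and the smaller factor D C of a rank
factorization A = C D is covered by the induction hypothesis. *)
Lemma nilpotent_mxtrace_expr (F : numFieldType) n (A : 'M[F]_n) :
  (forall k, \tr (A ^+ k.+1) = 0) -> exists N, A ^+ N = 0.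
Proof.
elim/ltn_ind: n A => -[|n] IHn A trA; first by exists 0; apply: thinmx0.
have rltn : (\rank A < n.+1)%N.
  rewrite ltn_neqAle rank_leq_row andbT.
  apply/negP => /eqP rA.
  have uA : A \in unitmx by rewrite -row_free_unit -row_leq_rank rA.
  have := @mxtrace_horner_mx _ _ _ (char_poly A) trA.
  rewrite Cayley_Hamilton mxtrace0 char_poly_det => /esym/eqP.
  rewrite mulrn_eq0 /= mulf_eq0 signr_eq0 /= => /eqP det0.
  by move: uA; rewrite unitmxE det0 unitr0.
have [|N BN] := IHn _ rltn (row_base A *m col_base A).
  by move=> k; rewrite mxtrace_expr_mulmx mulmx_base trA.
by exists N.+1; rewrite -(mulmx_base A) expr_mulmx_rot BN mulmx0 mul0mx.
Qed.

(** * Multiplication operators as matrices *)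

Section MultiplicationMatrices.
Context {R : realType} {V : vectType R}.
Implicit Types (br tri : {bilinear V -> V -> V}) (phi : {biscalar V}).
Local Notation b := (vbasis {:V}).
Local Notation bP := (vbasisP {:V}).

(** These matrices act on row vectors from the right, so a product of matrices
stands for the composite of the operators in the opposite order. *)
Definition lmulmx tri x := mxof b b (linfun (tri x)).
Definition rmulmx tri x := mxof b b (linfun (applyr tri x)).

Lemma rVof_lmulmx tri x y : rVof b (tri x y) = rVof b y *m lmulmx tri x.
Proof. by rewrite -(rVof_app _ bP) lfunE. Qed.

Lemma rVof_rmulmx tri x y : rVof b (tri y x) = rVof b y *m rmulmx tri x.
Proof. by rewrite -(rVof_app _ bP) lfunE. Qed.

Lemma mx_eq_on_rVof m (M N : 'M[R]_(\dim {:V}, m)) :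
  (forall y, rVof b y *m M = rVof b y *m N) -> M = N.
Proof.
move=> eqMN; apply/row_matrixP => i.
by rewrite !rowE -(vecofK bP (delta_mx 0 i)).
Qed.

Lemma lfun_trace_ad br x : lfun_trace (ad br x) = \tr (lmulmx br x).
Proof. by []. Qed.

Lemma rVof_iter_right_mul tri x n y :
  rVof b (iter n (right_mul tri x) y) = rVof b y *m rmulmx tri x ^+ n.
Proof.
elim: n => [|n IHn] /=; first by rewrite expr0 mulmx1.
by rewrite rVof_rmulmx IHn exprSr -mulmxE mulmxA.
Qed.

Lemma nilpotent_right_mulP tri x :
  nilpotent_map (right_mul tri x) <-> exists n, rmulmx tri x ^+ n = 0.
Proof.
split=> -[n nil]; exists n; last move=> y.
  by apply: mx_eq_on_rVof => y; rewrite -rVof_iter_right_mul nil mulmx0 linear0.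
by apply/eqP; rewrite -(rVof_eq0 bP) rVof_iter_right_mul nil mulmx0.
Qed.

(** * The trace of right multiplications *)

(** With G the Gram matrix of phi and L, A the matrices of L_x and ad_x, the
relation between product and bracket reads L G = - G A^T; as G is invertible,
L is similar to - A^T. *)
Lemma mxtrace_lmulmx_ad br phi tri x :
  Defs.nondegenerate phi -> ndb_product_of br phi tri ->
  \tr (lmulmx tri x) = - \tr (lmulmx br x).
Proof.
move=> nd tri_phi.
pose G : 'M[R]_(\dim {:V}) := \matrix_(i, j) phi b`_i b`_j.
have phiE u v : phi u v = (rVof b u *m G *m (rVof b v)^T) 0 0.
  rewrite [u in LHS](coord_basis bP (memvf u)).
  rewrite [v in LHS](coord_basis bP (memvf v)).
  rewrite linear_sumr mxE; apply: eq_bigr => j _.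
  rewrite linear_sumlz /= !mxE /= mulr_suml; apply: eq_bigr => i _.
  by rewrite linearZl_LR linearZr_LR /= !mxE mulrA mulrAC.
have uG : G \in unitmx.
  rewrite -row_free_unit -kermx_eq0; apply/rowV0P => u /sub_kermxP uG0.
  apply/eqP; rewrite -(vecof_eq0 bP); apply/eqP/(nondegenerate_inj nd) => z.
  by rewrite linear0l phiE (vecofK bP) uG0 mul0mx mxE.
suff LG : lmulmx tri x *m G = - (G *m (lmulmx br x)^T).
  rewrite -(mulmxK uG (lmulmx tri x)) LG mulNmx linearN /=.
  by rewrite mxtrace_mulC mulKmx // mxtrace_tr.
(* Two matrices agree when all their values y M z^T do. *)
apply: mx_eq_on_rVof => y; apply: trmx_inj; apply: mx_eq_on_rVof => z.
have swap (u v : 'rV[R]_(\dim {:V})) : v *m u^T = (u *m v^T)^T.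
  by rewrite trmx_mul trmxK.
rewrite swap [RHS]swap; congr (_^T); apply/matrixP => i j; rewrite !ord1.
have := tri_phi x y z; rewrite !phiE !rVof_lmulmx trmx_mul !mulmxA => ->.
by rewrite mulmxN mulNmx !mulmxA [RHS]mxE.
Qed.

(** Since ad_x = L_x - R_x, the trace of R_x is tr L_x - tr ad_x. *)
Lemma mxtrace_rmulmx br phi tri x :
  Defs.nondegenerate phi -> left_symmetric_structure br tri ->
  ndb_product_of br phi tri ->
  \tr (rmulmx tri x) = - (\tr (lmulmx br x) *+ 2).
Proof.
move=> nd [_ torsion] tri_phi.
have -> : rmulmx tri x = lmulmx tri x - lmulmx br x.
  apply: mx_eq_on_rVof => y.
  by rewrite mulmxBr -!(rVof_rmulmx, rVof_lmulmx) -linearB /= torsion subKr.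
by rewrite raddfB /= (mxtrace_lmulmx_ad _ _ _ _ nd tri_phi) mulr2n opprD.
Qed.

(** * Left-symmetric products whose right multiplications are traceless *)

(** This is the left-symmetry identity for the triple (y, x, v), regarded as an
equality of linear functions of y. *)
Lemma rmulmx_mul br tri x v : left_symmetric_structure br tri ->
  rmulmx tri (tri x v) = rmulmx tri x *m rmulmx tri v
    + (rmulmx tri v *m lmulmx tri x - lmulmx tri x *m rmulmx tri v).
Proof.
move=> [lsym _]; apply: mx_eq_on_rVof => y.
rewrite mulmxDr mulmxBr !mulmxA -!(rVof_rmulmx, rVof_lmulmx).
rewrite -!linearB -!linearD /=.
congr (rVof _ _); have /eqP := lsym y x v.
by rewrite subr_eq => /eqP ->; rewrite addrC addrA addrAC.
Qed.

(** The statement is generalized to tr (R_x (R_v)^j) = 0 for all x, so that the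
induction on j can trade one factor R_v for the replacement of x by x.v. *)
Lemma mxtrace_rmulmx_expr br tri v k : left_symmetric_structure br tri ->
  (forall x, \tr (rmulmx tri x) = 0) -> \tr (rmulmx tri v ^+ k.+1) = 0.
Proof.
move=> lsym tr0.
suff H j x : \tr (rmulmx tri x *m rmulmx tri v ^+ j) = 0.
  by rewrite exprS -mulmxE.
elim: j x => [|j IHj] x; first by rewrite expr0 mulmx1.
have := IHj (tri x v); rewrite (rmulmx_mul _ _ _ _ lsym).
rewrite !mulmxDl mulNmx raddfD raddfB /=.
have -> : \tr (rmulmx tri v *m lmulmx tri x *m rmulmx tri v ^+ j) =
  \tr (lmulmx tri x *m rmulmx tri v *m rmulmx tri v ^+ j).
  rewrite -mulmxA mxtrace_mulC -!mulmxA; congr (\tr (_ *m _)).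
  by rewrite !mulmxE -exprSr exprS.
by rewrite subrr addr0 -mulmxA mulmxE -exprS.
Qed.

End MultiplicationMatrices.

(** * Completeness and unimodularity *)

Theorem theorem3p7 (R : realType) (g : vectType R)
    (br : {bilinear g -> g -> g}) (hbr : lie_bracket br)
    (phi : {biscalar g}) (hphi : NDB_structure br phi)
    (tri : {bilinear g -> g -> g}) (htri : left_symmetric_structure br tri)
    (htri_phi : ndb_product_of br phi tri) :
  complete tri <-> unimodular br.
Proof.
have trR x := mxtrace_rmulmx _ _ _ x (proj1 hphi) htri htri_phi.
split=> [cpl x | unim x].
  have /nilpotent_right_mulP [n /mxtrace_nilpotent/eqP] := cpl x.
  by rewrite trR oppr_eq0 mulrn_eq0 /= => /eqP.
apply/nilpotent_right_mulP/nilpotent_mxtrace_expr => k.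
apply: (mxtrace_rmulmx_expr _ _ _ _ htri) => y.
by rewrite trR -lfun_trace_ad unim mul0rn oppr0.
Qed.
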